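(* Let $p,q$ be distinct primes, $n,m$ positive integers, $G=\mathrm{El}(p^n)\times\mathrm{El}(q^m)$, $\alpha=\frac{p^n-1}{p-1}$, $\beta=\frac{q^m-1}{q-1}$, $\gamma=\alpha\beta$. Let \[ T^D_1=\begin{bmatrix} 0& p^n-1 & (p^n-1)(q^m-1) & q^m-1\\ 1& 2p^n-p-2 & (2p^n-p-1)(q^m-1) & q^m-1\\ 1& 2p^n-p-1 & (p-1)(q-1)(2\gamma-1)-1 & 2q^m-q-1\\ 1& p^n-1 & (p^n-1)(2q^m-q-1) & 2q^m-q-2 \end{bmatrix}. \] Then the characteristic polynomial of the distance matrix of the enhanced power graph $\mathcal{G}_E(G)$ is \[ \phi_D(\mathcal{G}_E(G),x)=\phi(T^D_1,x)\,(x+1)^{p^nq^m-(\alpha+1)(\beta+1)}\,(x+(p-1)(q-1)+1)^{(\alpha-1)(\beta-1)} f(x)^{\alpha-1}g(x)^{\beta-1}, \] where $f(x)$ and $g(x)$ are the characteristic polynomials of $\begin{bmatrix} -p & (1-p)(q^m-1)\\ 1-p & (1-p)(q-1)-1\end{bmatrix}$ and $\begin{bmatrix}(p-1)(1-q)-1 & 1-q\\ (p^n-1)(1-q) & -q\end{bmatrix}$, respectively.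
   Context: $\mathrm{El}(p^n)$ denotes the elementary abelian group of order $p^n$. For a group $G$, the enhanced power graph $\mathcal{G}_E(G)$ is the simple graph with vertex set $G$ in which distinct $a,b$ are adjacent if and only if $a,b\in\langle c\rangle$ for some $c\in G$. The distance matrix of a connected graph has $(u,v)$-entry equal to the graph distance $d(u,v)$ (and $0$ on the diagonal). $\phi(B,x)=\det(xI-B)$ and $\phi_D(\Gamma,x)$ is the characteristic polynomial of the distance matrix of $\Gamma$. *)

(* Defs.v *)
From HB Require Import structures.
From mathcomp Require Import all_boot all_order all_algebra all_fingroup all_solvable.
Set Implicit Arguments.
Unset Strict Implicit.
Unset Printing Implicit Defensive.
Import GRing.Theory.
Local Open Scope ring_scope.

(* A simple graph on a finite vertex type is given by its adjacency relation. *)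
Section Graph.
Variables (T : finType) (e : rel T).

Definition walk (u v : T) (k : nat) : bool :=
  [exists s : k.-tuple T, path e u s && (last u s == v)].

(* The least length of a walk from u to v; #|T| if there is none. *)
Definition gdist (u v : T) : nat := find (walk u v) (iota 0 #|T|).

Definition dist_mx : 'M[int]_#|T| :=
  \matrix_(i, j) (gdist (enum_val i) (enum_val j))%:Z.

Lemma walk_gdist u v : connect e u v -> walk u v (gdist u v).
Proof.
case/connectP=> s0 /shortenP[s es us _] ->.
have sz : (size s < #|T|)%N by apply: leq_trans (max_card (mem (u :: s))); rewrite (card_uniqP us).
have hs : has (walk u (last u s)) (iota 0 #|T|).
  apply/hasP; exists (size s); first by rewrite mem_iota.
  by apply/existsP; exists (in_tuple s); rewrite es eqxx.
have := nth_find 0%N hs; rewrite nth_iota //.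
by rewrite has_find size_iota in hs.
Qed.

Lemma gdist_min u v k : walk u v k -> (k < #|T|)%N -> (gdist u v <= k)%N.
Proof.
move=> w kT; rewrite leqNgt; apply/negP => lt.
by have := before_find 0%N lt; rewrite nth_iota // w.
Qed.

End Graph.

Definition enhanced_power_graph (gT : finGroupType) : rel gT :=
  fun a b => (a != b) && [exists c : gT, (a \in <[c]>%g) && (b \in <[c]>%g)].

Definition mx_of_rows (k l : nat) (s : seq (seq int)) : 'M[int]_(k, l) :=
  \matrix_(i, j) nth 0 (nth [::] s i) j.

(* (p ^ n - 1) / (p - 1); the division is exact. *)
Definition num_lines (p n : nat) : nat := ((p ^ n - 1) %/ (p - 1))%N.

Section Matrices.
Variables p n q m : nat.
Let P : int := p%:Z.
Let Q : int := q%:Z.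
Let Pn : int := P ^+ n.
Let Qm : int := Q ^+ m.
Let c : int := (num_lines p n * num_lines q m)%N%:Z.

Definition T1D : 'M[int]_4 := mx_of_rows 4 4
  [:: [:: 0; Pn - 1;           (Pn - 1) * (Qm - 1);                 Qm - 1];
      [:: 1; 2 * Pn - P - 2;   (2 * Pn - P - 1) * (Qm - 1);         Qm - 1];
      [:: 1; 2 * Pn - P - 1;   (P - 1) * (Q - 1) * (2 * c - 1) - 1; 2 * Qm - Q - 1];
      [:: 1; Pn - 1;           (Pn - 1) * (2 * Qm - Q - 1);         2 * Qm - Q - 2]].

Definition f_mx : 'M[int]_2 := mx_of_rows 2 2
  [:: [:: - P;   (1 - P) * (Qm - 1)];
      [:: 1 - P; (1 - P) * (Q - 1) - 1]].

Definition g_mx : 'M[int]_2 := mx_of_rows 2 2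
  [:: [:: (P - 1) * (1 - Q) - 1; 1 - Q];
      [:: (Pn - 1) * (1 - Q);    - Q]].

End Matrices.

(* Main.v *)
Require Import Defs.
From HB Require Import structures.
From mathcomp Require Import all_boot all_order all_algebra all_fingroup all_solvable.
From mathcomp Require Import zify ring.
Set Implicit Arguments.
Unset Strict Implicit.
Unset Printing Implicit Defensive.
Import GRing.Theory.
Local Open Scope ring_scope.

(** Any two distinct vertices are at distance 1 or 2, since the identity is
    adjacent to everything.  Hence [D + I = 2J - M], where [M u v] says that
    [u] and [v] lie in a common cyclic subgroup.  Writing [u = a b] with [a] in
    [A] and [b] in [B], this depends only on the pair of cyclic subgroups
    generated by [a] and by [b], so Sylvester's determinant identity reduces
    [x - D] to the (alpha + 1)(beta + 1) pairs, at the price of a power of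
    [x + 1].  The alpha nontrivial lines of [A] are interchangeable, hence so are
    the corresponding blocks of the reduced matrix: lumping them splits off a
    power of a determinant indexed by the lines of [B], and lumping the lines of
    [B] in both factors leaves [T1D], [f_mx], [g_mx] and a linear factor. *)

(** * Determinants indexed by a finite type *)

Section Fdet.
Variable R : comNzRingType.

(** Going through [enum_val] lets sums, products and options of types index rows and columns, so
    that block structure shows in the index type. *)
Definition fdet (T : finType) (F : T -> T -> R) : R :=
  \det (\matrix_(i < #|T|, j < #|T|) F (enum_val i) (enum_val j)).

Lemma eq_fdet (T : finType) (F G : T -> T -> R) : F =2 G -> fdet F = fdet G.
Proof. by move=> FG; congr (\det _); apply/matrixP=> i j; rewrite !mxE FG. Qed.

Lemma fdet_tr (T : finType) (F : T -> T -> R) :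
  fdet (fun i j => F j i) = fdet F.
Proof. by rewrite /fdet -det_tr; congr (\det _); apply/matrixP=> i j; rewrite !mxE. Qed.

(** Rows and columns undergo the same permutation, so its sign appears twice and cancels. In
    particular the enumeration chosen in [fdet] is immaterial. *)
Lemma fdet_ord (T : finType) (n : nat) (h : 'I_n -> T) (F : T -> T -> R) :
  bijective h -> \det (\matrix_(i, j) F (h i) (h j)) = fdet F.
Proof.
move=> bij_h; have En : n = #|T| by rewrite -(bij_eq_card bij_h) card_ord.
move: h bij_h; rewrite {n}En => h bij_h.
have inj_s : injective (fun i => enum_rank (h i)).
  by move=> i j /enum_rank_inj /(bij_inj bij_h).
pose s := perm inj_s; rewrite /fdet; set M := (X in _ = \det X).
have -> : \matrix_(i, j) F (h i) (h j) = row_perm s (col_perm s M).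
  by apply/matrixP=> i j; rewrite !mxE !permE !enum_rankK.
rewrite row_permE col_permE !det_mulmx !det_perm odd_permV.
by rewrite mulrCA -signr_addb addbb mulr1.
Qed.

Lemma fdet_bij (S T : finType) (h : S -> T) (F : T -> T -> R) :
  bijective h -> fdet F = fdet (fun i j => F (h i) (h j)).
Proof.
move=> bij_h.
by rewrite -(fdet_ord F (bij_comp bij_h (@enum_val_bij S))).
Qed.

Lemma fdet_ublock (S T : finType) (F : S + T -> S + T -> R) :
    (forall t s, F (inr t) (inl s) = 0) ->
  fdet F = fdet (fun s s' => F (inl s) (inl s'))
           * fdet (fun t t' => F (inr t) (inr t')).
Proof.
move=> F0; pose h (i : 'I_(#|S| + #|T|)) : S + T :=
  match split i with inl j => inl (enum_val j) | inr k => inr (enum_val k) end.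
pose h' (x : S + T) : 'I_(#|S| + #|T|) :=
  unsplit (match x with inl s => inl (enum_rank s) | inr t => inr (enum_rank t) end).
have bij_h : bijective h.
  exists h' => [i|[s|t]]; rewrite /h /h'; last 2 first.
  - by rewrite unsplitK enum_rankK.
  - by rewrite unsplitK enum_rankK.
  by rewrite -[RHS]splitK; case: (split i) => j; rewrite enum_valK.
rewrite -(fdet_ord F bij_h) /fdet.
rewrite -(det_ublock _ (\matrix_(i, j) F (inl (enum_val i)) (inr (enum_val j)))).
congr (\det _); apply/matrixP=> i j; rewrite -[i]splitK -[j]splitK.
by rewrite mxE /h !unsplitK; case: (split i) => i'; case: (split j) => j';
  rewrite /= ?block_mxEul ?block_mxEur ?block_mxEdl ?block_mxEdr !mxE.
Qed.

Lemma fdet_diag (T : finType) (x : R) :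
  fdet (fun i j : T => x *+ (i == j)) = x ^+ #|T|.
Proof.
rewrite -det_scalar; congr (\det _).
by apply/matrixP=> i j; rewrite !mxE (inj_eq enum_val_inj).
Qed.

Lemma fdet1 (T : finType) : fdet (fun i j : T => (i == j)%:R) = 1.
Proof. by rewrite fdet_diag expr1n. Qed.

Lemma fdet_mul (T : finType) (F G : T -> T -> R) :
  fdet (fun i j => \sum_k F i k * G k j) = fdet F * fdet G.
Proof.
rewrite /fdet -det_mulmx; congr (\det _); apply/matrixP=> i j; rewrite !mxE.
rewrite (reindex (@enum_val T T)) /=; last exact: onW_bij (@enum_val_bij T).
by apply: eq_bigr => k _; rewrite !mxE.
Qed.

(** * Row and column operations, and lumping of classes *)

Lemma sum_deltal (T : finType) (t : T) (F : T -> R) :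
  \sum_k (t == k)%:R * F k = F t.
Proof.
rewrite (bigD1 t) //= eqxx mul1r big1 ?addr0 // => k /negPf kt.
by rewrite eq_sym kt mul0r.
Qed.

(** This is left multiplication by the block unitriangular matrix [L], of determinant 1. *)
Lemma fdet_row_op (S T : finType) (r : T -> S) (F : S + T -> S + T -> R) :
  fdet F = fdet (fun u v => match u with
                            | inl _ => F u v
                            | inr t => F u v - F (inl (r t)) v end).
Proof.
pose L (u w : S + T) : R :=
  (u == w)%:R - (if u is inr t then (inl (r t) == w)%:R else 0).
have detL : fdet L = 1.
  rewrite -fdet_tr fdet_ublock => [|t s]; last first.
    by rewrite /L -[_ == _]/false subr0.
  rewrite -[RHS]mulr1 -[X in _ = X * _](fdet1 S) -[X in _ = _ * X](fdet1 T).
  by congr (_ * _); apply: eq_fdet => i j; rewrite /L ?subr0 -?[inl _ == inr _]/false ?subr0 eq_sym.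
rewrite -[LHS]mul1r -detL -fdet_mul; apply: eq_fdet => u v.
under eq_bigr => k _ do rewrite /L mulrBl.
rewrite sumrB sum_deltal; case: u => [s|t]; last by rewrite sum_deltal.
by rewrite big1 ?subr0 // => k _; rewrite mul0r.
Qed.

(** Right multiplication by a block unitriangular matrix collects the columns of each class into
    that of its representative. *)
Lemma fdet_col_op (S T : finType) (r : T -> S) (F : S + T -> S + T -> R) :
  fdet F = fdet (fun u v => match v with
                            | inl s => F u v + \sum_(t | r t == s) F u (inr t)
                            | inr _ => F u v end).
Proof.
pose L (w v : S + T) : R :=
  (w == v)%:R + (if v is inl s then if w is inr t then (r t == s)%:R else 0 else 0).
have detL : fdet L = 1.
  rewrite -fdet_tr fdet_ublock => [|t s]; last first.
    by rewrite /L -[_ == _]/false addr0.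
  rewrite -[RHS]mulr1 -[X in _ = X * _](fdet1 S) -[X in _ = _ * X](fdet1 T).
  by congr (_ * _); apply: eq_fdet => i j; rewrite /L ?addr0 eq_sym.
rewrite -[LHS]mulr1 -detL -fdet_mul; apply: eq_fdet => u v.
under eq_bigr => k _ do rewrite /L mulrDr eq_sym [X in X + _]mulrC.
rewrite big_split /= sum_deltal; case: v => [s|t]; last first.
  by rewrite big1 ?addr0 // => k _; rewrite mulr0.
congr (_ + _); rewrite big_sumType /= big1 ?add0r => [|k _]; last by rewrite mulr0.
rewrite [RHS]big_mkcond; apply: eq_bigr => t _.
by case: (_ == _); rewrite ?mulr1 ?mulr0.
Qed.

(* The equitable partition theorem: [inl s] represents its class, [r] sends the
   other indices to their representative, and the hypothesis says that the sum
   of a row over a class depends only on the class of the row. *)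
Lemma fdet_equitable (S T : finType) (r : T -> S) (F : S + T -> S + T -> R) :
    let Q u s := F u (inl s) + \sum_(t | r t == s) F u (inr t) in
    (forall t s, Q (inr t) s = Q (inl (r t)) s) ->
  fdet F = fdet (fun s s' => Q (inl s) s')
           * fdet (fun t t' => F (inr t) (inr t') - F (inl (r t)) (inr t')).
Proof.
(* After both operations the lower left entries are [Q (inr t) s - Q (inl (r t)) s], which vanish by
   hypothesis. *)
move=> Q eqQ; rewrite (fdet_col_op r) (fdet_row_op r) fdet_ublock // => t s.
by rewrite -/(Q _ _) -/(Q _ _) eqQ subrr.
Qed.

Lemma fdet_blockdiag (K : finType) (a : nat) (X : K -> K -> R) :
  fdet (fun u v : 'I_a * K => X u.2 v.2 *+ (u.1 == v.1)) = fdet X ^+ a.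
Proof.
elim: a => [|a IHa].
  rewrite /fdet expr0; set M := \matrix_(_, _) _; move: M.
  by rewrite card_prod card_ord => M; rewrite det_mx00.
pose h (x : K + 'I_a * K) : 'I_a.+1 * K :=
  match x with inl k => (ord0, k) | inr (i, k) => (lift ord0 i, k) end.
pose h' (x : 'I_a.+1 * K) : K + 'I_a * K :=
  if unlift ord0 x.1 is Some i then inr (i, x.2) else inl x.2.
have bij_h : bijective h.
  exists h' => [[k|[i k]]|[i k]]; rewrite /h /h' /= ?unlift_none ?liftK //.
  by case: unliftP => [j|] ->.
rewrite (fdet_bij _ bij_h) fdet_ublock => [|[i k] l] //; rewrite exprS -IHa.
congr (_ * _); apply: eq_fdet => // -[i k] [j l].
by rewrite /= (inj_eq lift_inj).
Qed.

(* [false] indexes the border and [true] the lumped [a.+1] equal blocks. *)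
Lemma fdet_bordered (K : finType) (a : nat) (W U V X Y : K -> K -> R) :
  fdet (fun u v : option 'I_a.+1 * K =>
          match u.1, v.1 with
          | None, None => W u.2 v.2
          | None, Some _ => U u.2 v.2
          | Some _, None => V u.2 v.2
          | Some i, Some j => X u.2 v.2 *+ (i == j) + Y u.2 v.2
          end)
  = fdet (fun u v : bool * K =>
            match u.1, v.1 with
            | false, false => W u.2 v.2
            | false, true => U u.2 v.2 *+ a.+1
            | true, false => V u.2 v.2
            | true, true => X u.2 v.2 + Y u.2 v.2 *+ a.+1
            end) * fdet X ^+ a.
Proof.
pose h (x : (bool * K) + ('I_a * K)) : option 'I_a.+1 * K :=
  match x with
  | inl (b, k) => (if b then Some ord0 else None, k)
  | inr (i, k) => (Some (lift ord0 i), k)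
  end.
pose h' (x : option 'I_a.+1 * K) : (bool * K) + ('I_a * K) :=
  if x.1 is Some i then
    if unlift ord0 i is Some j then inr (j, x.2) else inl (true, x.2)
  else inl (false, x.2).
have bij_h : bijective h.
  exists h' => [[[[] k]|[i k]]|[[i|] k]]; rewrite /h /h' /= ?unlift_none ?liftK //.
  by case: unliftP => [j|] ->.
rewrite (fdet_bij _ bij_h).
(* Block [ord0] represents all the equal blocks; each border index is alone in its class. *)
pose r (t : 'I_a * K) := (true, t.2).
have sumr (G : 'I_a * K -> R) (b : bool) (l : K) :
    \sum_(t | r t == (b, l)) G t = (\sum_i G (i, l)) *+ b.
  case: b; last first.
    by rewrite mulr0n big1 // => -[i k]; rewrite /r xpair_eqE.
  rewrite mulr1n; under [RHS]eq_bigr => i _ do rewrite -(big_pred1_eq +%R l (fun k => G (i, k))).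
  rewrite pair_big /=; apply: eq_big => [[i k]|[i k] _] //.
have lift0F i : (ord0 == lift ord0 i :> 'I_a.+1) = false by [].
have liftF0 i : (lift ord0 i == ord0 :> 'I_a.+1) = false by [].
rewrite (fdet_equitable (r := r)).
  congr (_ * _).
    apply: eq_fdet => -[b k] [b' l]; rewrite sumr.
    case: b b' => [] [] /=; rewrite ?mulr0n ?addr0 ?mulr1n //.
      under eq_bigr => i _ do rewrite add0r.
      by rewrite sumr_const card_ord -addrA -mulrS.
    by rewrite sumr_const card_ord -mulrS.
  rewrite -fdet_blockdiag; apply: eq_fdet => -[i k] [j l] /=.
  by rewrite (inj_eq lift_inj) ?lift0F ?mulr0n add0r addrK.
(* Every block row meets [X] once, on the diagonal, and [Y] in all [a.+1] blocks, so its class sums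
   do not depend on the block. *)
move=> [i k] [b l]; rewrite /r !sumr /=; case: b => //=.
rewrite ?liftF0 ?mulr1n ?mulr0n add0r.
under eq_bigr => j _ do rewrite (inj_eq lift_inj).
rewrite big_split /= (bigD1 i) //= eqxx mulr1n big1 => [|j /negPf ji]; last first.
  by rewrite eq_sym ji mulr0n.
by rewrite addr0 addrCA addrA.
Qed.

(* Sylvester's identity [det (x - L M) x^|C| = x^|T| det (x - M L)], where [L]
   is the indicator matrix of [pi]. *)
Lemma fdet_fibres (T C : finType) (pi : T -> C) (k : C -> C -> R) (x : R) :
  fdet (fun u v => x *+ (u == v) - k (pi u) (pi v)) * x ^+ #|C|
  = x ^+ #|T| * fdet (fun c d => x *+ (c == d) - k c d *+ #|[pred t | pi t == d]|).
Proof.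
pose L : 'M[R]_(#|T|, #|C|) := \matrix_(i, j) (pi (enum_val i) == enum_val j)%:R.
pose M : 'M[R]_(#|C|, #|T|) := \matrix_(i, j) k (enum_val i) (pi (enum_val j)).
have -> : fdet (fun u v => x *+ (u == v) - k (pi u) (pi v)) = \det (x%:M - L *m M).
  congr (\det _); apply/matrixP=> i j; rewrite !mxE (inj_eq enum_val_inj).
  congr (_ - _); rewrite -[LHS](sum_deltal _ (fun c => k c (pi (enum_val j)))).
  rewrite (reindex (@enum_val C C)) /=; last exact: onW_bij (@enum_val_bij C).
  by apply: eq_bigr => c _; rewrite !mxE.
have -> : fdet (fun c d => x *+ (c == d) - k c d *+ #|[pred t | pi t == d]|)
    = \det (x%:M - M *m L).
  congr (\det _); apply/matrixP=> i j; rewrite !mxE (inj_eq enum_val_inj).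
  congr (_ - _); rewrite -sumr_const big_mkcond /=.
  rewrite (reindex (@enum_val T T)) /=; last exact: onW_bij (@enum_val_bij T).
  apply: eq_bigr => t _; rewrite !mxE inE.
  by case: eqP => [->|_]; rewrite ?mulr1 ?mulr0.
(* The determinant of [B] is computed by clearing [M] in two ways; no inverse of [x] is needed,
   whence the powers of [x] in the statement. *)
pose B := block_mx x%:M L M 1%:M.
have detB : \det B = \det (x%:M - L *m M).
  have /(congr1 (fun Z => \det Z)) : B *m block_mx 1%:M 0 (- M) 1%:M
      = block_mx (x%:M - L *m M) L 0 1%:M.
    rewrite mulmx_block !mulmx1 !mulmx0 mulmxN !mul1mx.
    by rewrite !add0r subrr.
  by rewrite det_mulmx det_lblock det_ublock !det1 !mulr1.
rewrite -detB mulrC.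
have /(congr1 (fun Z => \det Z)) : block_mx 1%:M 0 (- M) x%:M *m B
    = block_mx x%:M L 0 (x%:M - M *m L).
  rewrite mulmx_block !mul1mx !mul0mx !addr0 mulmx1 !mulNmx.
  by rewrite mul_mx_scalar mul_scalar_mx addNr addrC.
by rewrite det_mulmx det_lblock det_ublock !det_scalar expr1n mul1r.
Qed.

End Fdet.

(** * Lines of an elementary abelian group *)

Section Lines.
Variables (gT : finGroupType) (p : nat).
Implicit Type A : {group gT}.

Definition lines A : {set {set gT}} := [set <[a]>%g | a in A^#%g].

(** All nonidentity elements have order [p], so one lying in [<[a]>] generates it by cardinality. *)
Lemma cycle_gens A (a : gT) : (p.-abelem A)%g -> a \in A^#%g ->
  [set b in A^#%g | <[b]>%g == <[a]>%g] = (<[a]>^#)%g.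
Proof.
move=> abelA /setD1P[a1 Aa]; have oa := abelem_order_p abelA Aa a1.
have sA : <[a]>%g \subset A by rewrite cycle_subG.
apply/setP=> b; rewrite !inE -andbA; apply: andb_id2l => b1.
apply/andP/idP=> [[_ /eqP <-]|ab]; first exact: cycle_id.
have Ab := subsetP sA _ ab; split=> //.
rewrite eqEcard cycle_subG ab -!orderE oa.
by rewrite (abelem_order_p abelA Ab b1) leqnn.
Qed.

Lemma card_cycle_gens A (a : gT) : (p.-abelem A)%g -> a \in A^#%g ->
  #|[set b in A^#%g | <[b]>%g == <[a]>%g]| = p.-1.
Proof.
move=> abelA Aa; rewrite cycle_gens //.
have /setD1P[a1 Aa'] := Aa.
by rewrite cardsDS ?sub1set ?group1 // cards1 -orderE (abelem_order_p abelA) // subn1.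
Qed.

(** The nonidentity elements are partitioned by the line they generate, with [p.-1] generators on
    each. *)
Lemma card_lines A : (p.-abelem A)%g -> (#|lines A| * p.-1 = #|A| - 1)%N.
Proof.
move=> abelA.
have -> : (#|A| - 1)%N = #|A^#%g| by rewrite cardsDS ?sub1set ?group1 // cards1.
rewrite -[RHS]sum1_card (partition_big_imset (fun a => <[a]>%g)) /= -sum_nat_const.
apply: eq_bigr => _ /imsetP[a Aa ->]; rewrite -(card_cycle_gens abelA Aa) -sum1_card.
by apply: eq_bigl => b; rewrite inE.
Qed.

Lemma num_linesM (n : nat) : prime p -> (num_lines p n * p.-1 = p ^ n - 1)%N.
Proof.
move=> p_pr; rewrite -subn1 /num_lines divnK // subn1 -[1%N](exp1n n).
by rewrite -subn1 subn_exp dvdn_mulr.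
Qed.

Lemma card_linesE A (n : nat) : prime p -> (p.-abelem A)%g -> #|A| = (p ^ n)%N ->
  #|lines A| = num_lines p n.
Proof.
move=> p_pr abelA cardA; have p1 : (0 < p.-1)%N by case: p p_pr => [|[]].
apply/eqP; rewrite -(eqn_pmul2r p1); apply/eqP.
by rewrite card_lines // num_linesM // cardA.
Qed.

Definition line_size (T : Type) (c : option T) : nat := if c is Some _ then p.-1 else 1%N.

(** On classes of elements, this is the criterion of [abelem_cocyclic] for lying in a common cyclic
    subgroup. *)
Definition compat (T : eqType) (c d : option T) : bool :=
  [|| c == None, d == None | c == d].

Lemma compatE (T : eqType) (c d : option T) :
  compat c d = if c is Some i then if d is Some j then i == j else true else true.
Proof. by case: c d => [i|] [j|]. Qed.

(* [Some i] is the [i]-th line; [None] is the class of the identity. *)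
Lemma line_index A (n : nat) :
    prime p -> (p.-abelem A)%g -> #|A| = (p ^ n)%N ->
  exists h : gT -> option 'I_(num_lines p n),
    [/\ {in A, forall a, (h a == None) = (a == 1%g)},
        {in A &, forall a b, (h a == h b) = (<[a]>%g == <[b]>%g)}
      & forall c, #|[set a in A | h a == c]| = line_size c].
Proof.
move=> p_pr abelA cardA; rewrite -(card_linesE p_pr abelA cardA).
pose ix (a : gT) := index <[a]>%g (enum (lines A)).
(* A subgroup that is not a line has index [#|lines A|], which is out of range, and [insub] returns
   [None]; within [A] this happens at the identity only. *)
pose h (a : gT) : option 'I_#|lines A| := insub (ix a).
have lineP a : a \in A -> (ix a < #|lines A|)%N = (a != 1%g).
  move=> Aa; rewrite cardE index_mem mem_enum; apply/imsetP/idP => [[b]|a1].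
    by case/setD1P=> b1 _ eab; rewrite -cycle_eq1 eab cycle_eq1.
  by exists a; rewrite // !inE a1.
have h1 : {in A, forall a, (h a == None) = (a == 1%g)}.
  move=> a Aa; rewrite /h; case: insubP => [i|]; rewrite lineP ?negbK //.
  by move=> /negPf ->.
have hh : {in A &, forall a b, (h a == h b) = (<[a]>%g == <[b]>%g)}.
  move=> a b Aa Ab; have [a1|a1] := eqVneq a 1%g.
    have /eqP -> : h a == None by rewrite h1 // a1.
    by rewrite eq_sym h1 // a1 cycle1 [RHS]eq_sym cycle_eq1.
  apply/eqP/eqP => [|eab]; last by rewrite /h /ix eab.
  rewrite /h; case: insubP => [i|]; rewrite lineP // a1 // => _ ia.
  case: insubP => [j _ jb [ij]|//]; move: ia jb; rewrite ij => -> /esym.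
  rewrite /ix => eq_ix; have mem x : x \in A^#%g -> <[x]>%g \in enum (lines A).
    by rewrite mem_enum; apply: imset_f.
  have Aa1 : a \in A^#%g by rewrite !inE a1.
  rewrite -(nth_index set0 (mem _ Aa1)) -eq_ix nth_index //.
  by rewrite -index_mem eq_ix index_mem mem.
exists h; split=> // -[i|] /=; last first.
  rewrite (_ : [set _ in _ | _] = [set 1%g]) ?cards1 //.
  apply/setP=> a; rewrite !inE; case Aa: (a \in A); first by rewrite h1.
  by apply/esym/negP => /eqP a1; rewrite a1 group1 in Aa.
have : nth set0 (enum (lines A)) i \in lines A.
  by rewrite -mem_enum mem_nth // -cardE.
case/imsetP => a Aa1 Ea; have /setD1P[a1 Aa] := Aa1.
have ha : h a = Some i.
  rewrite /h /ix -Ea index_uniq ?enum_uniq -?cardE //.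
  by rewrite insubT => [//|lt]; congr Some; apply: val_inj.
rewrite -(card_cycle_gens abelA Aa1); apply: eq_card => b.
rewrite !inE; case Ab: (b \in A); rewrite ?andbF //= andbT -ha hh //.
case: (eqVneq b 1%g) => //= ->; apply/negbTE.
by rewrite cycle1 eq_sym cycle_eq1.
Qed.

End Lines.

(** * The distance matrix of the enhanced power graph *)

Section Dominating.
Variables (T : finType) (e : rel T) (z : T).

Lemma walk0 (u v : T) : walk e u v 0 = (u == v).
Proof.
apply/existsP/idP => [[s]|uv]; first by rewrite tuple0.
by exists [tuple].
Qed.

Lemma walk1 (u v : T) : walk e u v 1 = e u v.
Proof.
apply/existsP/idP => [[s]|uv]; last by exists [tuple v]; rewrite /= uv eqxx.
by case/tupleP: s => x s; rewrite tuple0 /= andbT => /andP[ux /eqP <-].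
Qed.

(** Any two vertices are joined by a walk of length two through [z]; walks of length 0 and 1 mean
    equality and adjacency. *)
Lemma gdist_dominating (u v : T) :
    (forall w, w != z -> e w z && e z w) ->
  gdist e u v = if u == v then 0%N else if e u v then 1%N else 2%N.
Proof.
move=> domz; have w0 : (0 < #|T|)%N by apply/card_gt0P; exists u.
case: eqVneq => [<-|uv].
  by apply/eqP; rewrite -leqn0 gdist_min ?walk0.
have w1 : (1 < #|T|)%N.
  apply: leq_trans (max_card (mem [:: u; v])); rewrite (card_uniqP _) //=.
  by rewrite inE uv.
case uve: (e u v).
  have d1 : (gdist e u v <= 1)%N by rewrite gdist_min ?walk1.
  have := walk_gdist (connect1 uve); case: (gdist e u v) d1 => [|[|//]] //.
  by rewrite walk0 (negPf uv).
have uz : u != z.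
  apply: contraFneq uve => uz; have vz : v != z by rewrite -uz eq_sym.
  by have /andP[_] := domz v vz; rewrite uz.
have vz : v != z.
  by apply: contraFneq uve => ->; have /andP[] := domz u uz.
have /andP[euz _] := domz u uz; have /andP[_ ezv] := domz v vz.
(* [gdist] only searches lengths below [#|T|], so length 2 is found only if there are three distinct
   vertices. *)
have w2 : (2 < #|T|)%N.
  apply: leq_trans (max_card (mem [:: u; v; z])); rewrite (card_uniqP _) //=.
  by rewrite !inE negb_or uv uz vz.
have d2 : (gdist e u v <= 2)%N.
  by apply: gdist_min w2; apply/existsP; exists [tuple z; v]; rewrite /= euz ezv eqxx.
have := walk_gdist (connect_trans (connect1 euz) (connect1 ezv)).
case: (gdist e u v) d2 => [|[|[|//]]] //; first by rewrite walk0 (negPf uv).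
by rewrite walk1 uve.
Qed.

End Dominating.

(** * Pairs of elements in a common cyclic subgroup *)

Section Cocyclic.
Variable gT : finGroupType.

Definition cocyclic (a b : gT) : bool :=
  [exists c : gT, (a \in <[c]>%g) && (b \in <[c]>%g)].

(** This is the identity [D + I + M = 2J] entry by entry, kept additive to avoid truncated
    subtraction. The identity element is the dominating vertex. *)
Lemma gdist_enhanced_power_graph (u v : gT) :
  (gdist (@enhanced_power_graph gT) u v + (u == v) + cocyclic u v = 2)%N.
Proof.
rewrite (@gdist_dominating _ _ 1%g) => [|w w1]; last first.
  rewrite /enhanced_power_graph [1%g == w]eq_sym w1 /=; apply/andP.
  by split; apply/existsP; exists w; rewrite cycle_id group1.
rewrite /enhanced_power_graph -/(cocyclic u v).
case: eqVneq => [<-|uv] /=; last by case: (cocyclic u v).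
suff -> : cocyclic u u by [].
by apply/existsP; exists u; rewrite cycle_id.
Qed.

(** A cyclic group has at most one subgroup of each order, and nonidentity elements of [A] all have
    order [p]. *)
Lemma abelem_cocyclic (p : nat) (A : {group gT}) (a b : gT) :
    (p.-abelem A)%g -> a \in A -> b \in A ->
  cocyclic a b = [|| a == 1%g, b == 1%g | <[a]>%g == <[b]>%g].
Proof.
move=> abelA Aa Ab; apply/existsP/idP => [[c /andP[ac bc]]|].
  case: eqVneq => //= a1; case: eqVneq => //= b1.
  rewrite (eq_subG_cyclic (cycle_cyclic c)) ?cycle_subG //.
  by rewrite -!orderE !(abelem_order_p abelA).
case/or3P=> [/eqP->|/eqP->|/eqP eab].
- by exists b; rewrite group1 cycle_id.
- by exists a; rewrite group1 cycle_id.
by exists b; rewrite -eab cycle_id /= eab cycle_id.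
Qed.

End Cocyclic.

(** * Elementary abelian factors for distinct primes *)

Section DirectProduct.
Variables (gT : finGroupType) (p q : nat) (A B : {group gT}).
Hypotheses (p_pr : prime p) (q_pr : prime q) (p_neq_q : p <> q).
Hypotheses (abelA : (p.-abelem A)%g) (abelB : (q.-abelem B)%g).
Hypothesis defG : (A \x B)%g = [set: gT].

Lemma cycle_coprime_mul (a b : gT) : a \in A -> b \in B ->
  <[a * b]>%g = (<[a]> * <[b]>)%g.
Proof.
move=> Aa Bb; have [_ _ cAB _] := dprodP defG; apply: cycleM.
  exact/commute_sym/(centsP cAB).
have [_ /(_ a Aa) ap] := abelemP p_pr abelA.
have [_ /(_ b Bb) bq] := abelemP q_pr abelB.
apply: (@coprime_dvdl _ p); first by rewrite order_dvdn ap.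
apply: (@coprime_dvdr _ q); first by rewrite order_dvdn bq.
by rewrite prime_coprime // dvdn_prime2 //; apply/eqP.
Qed.

(** By coprimality [<[a * b]>] contains both [a] and [b], which gives one direction; for the other,
    generators for the two factors are multiplied. *)
Lemma cocyclic_mul (a a' b b' : gT) : a \in A -> a' \in A -> b \in B -> b' \in B ->
  cocyclic (a * b) (a' * b') = cocyclic a a' && cocyclic b b'.
Proof.
move=> Aa Aa' Bb Bb'; apply/idP/idP.
  have sub x y : x \in A -> y \in B -> (x \in <[x * y]>%g) && (y \in <[x * y]>%g).
    move=> Ax By; rewrite cycle_coprime_mul //.
    by rewrite (subsetP (mulG_subl _ _)) ?(subsetP (mulG_subr _ _)) ?cycle_id.
  case/existsP=> c; rewrite -!cycle_subG => /andP[/subsetP abc /subsetP abc'].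
  have /andP[ac bc] := sub a b Aa Bb; have /andP[ac' bc'] := sub a' b' Aa' Bb'.
  by apply/andP; split; apply/existsP; exists c; rewrite abc // abc'.
rewrite (abelem_cocyclic abelA) // (abelem_cocyclic abelB) //.
(* The common generator must be taken inside the factor for [cycle_coprime_mul] to apply; [cocyclic]
   alone does not locate it. *)
have gen (C : {group gT}) (x y : gT) : x \in C -> y \in C ->
    [|| x == 1%g, y == 1%g | <[x]>%g == <[y]>%g] ->
    exists2 c, c \in C & (x \in <[c]>%g) /\ (y \in <[c]>%g).
  move=> Cx Cy /or3P[/eqP->|/eqP->|/eqP exy].
  - by exists y; rewrite // group1 cycle_id.
  - by exists x; rewrite // group1 cycle_id.
  by exists x; rewrite // {2}exy !cycle_id.
case/andP=> /(gen A _ _ Aa Aa')[c Ac [ac ac']] /(gen B _ _ Bb Bb')[d Bd [bd bd']].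
by apply/existsP; exists (c * d)%g; rewrite cycle_coprime_mul // !mem_mulg.
Qed.

(** The map sending [g] to its two components is injective, and [a * b] is a preimage of
    [(a, b)]. *)
Lemma card_dprod_fibre (S : {set gT}) (S' : {set gT}) :
    S \subset A -> S' \subset B ->
  #|[pred g | (divgr A B g \in S) && (remgr A B g \in S')]| = (#|S| * #|S'|)%N.
Proof.
move=> sSA sSB; have [_ defAB _ tiAB] := dprodP defG.
have inAB g : g \in (A * B)%g by rewrite defAB inE.
rewrite -cardsX -(card_in_imset (f := fun g => (divgr A B g, remgr A B g)))
  => [|g g' _ _ [e1 e2]]; last by rewrite [g](divgr_eq A B) [g'](divgr_eq A B) e1 e2.
apply: eq_card => -[a b]; rewrite inE /=; apply/imsetP/andP => [[g gS [-> ->]]|[Sa Sb]].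
  by apply/andP.
have [Aa Bb] := (subsetP sSA a Sa, subsetP sSB b Sb).
by exists (a * b)%g; rewrite ?inE divgrMid // remgrMid // Sa Sb.
Qed.

End DirectProduct.

(** * The quotient by lines *)

Lemma fdet_unit (R : comNzRingType) (x : R) : fdet (fun _ _ : unit => x) = x.
Proof.
rewrite -[RHS]expr1 -card_unit -fdet_diag.
by apply: eq_fdet => -[] [].
Qed.

Lemma fdet_char_poly (T : finType) (n : nat) (h : 'I_n -> T) (M : 'M[int]_n)
    (F : T -> T -> {poly int}) : bijective h ->
    (forall i j, F (h i) (h j) = 'X *+ (i == j) - (M i j)%:P) ->
  fdet F = char_poly M.
Proof.
move=> bij_h FM; rewrite -(fdet_ord F bij_h) /char_poly; congr (\det _).
by apply/matrixP=> i j; rewrite mxE FM !mxE.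
Qed.

Lemma polyC_Posz (n : nat) : (n%:Z)%:P = n%:R :> {poly int}.
Proof. by rewrite -natz rmorph_nat. Qed.

Lemma num_lines_Posz (p n : nat) : prime p ->
  p%:Z ^+ n = (num_lines p n)%:Z * p.-1%:Z + 1.
Proof.
move=> p_pr; rewrite -PoszM num_linesM //.
have p_gt0 : (0 < p ^ n)%N by rewrite expn_gt0 prime_gt0.
by rewrite -[1]/(1%N : int) -PoszD subnK // -!natz natrX.
Qed.

(** * Lumping the lines of each factor *)

Section Quotient.
Variables (a b p q n m : nat).
Hypotheses (p_pr : prime p.+1) (q_pr : prime q.+1).
Hypotheses (num_p : num_lines p.+1 n = a.+1) (num_q : num_lines q.+1 m = b.+1).
Let R : comNzRingType := {poly int}.
Let y : R := 'X + 1.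

(** In this section the primes are [p.+1] and [q.+1] and the line counts [a.+1] and [b.+1], so [p]
    and [q] count the generators of a line and no truncated subtraction reaches [ring]. *)
Lemma expz_p : p.+1%:Z ^+ n = a.+1%:Z * p%:Z + 1.
Proof. by rewrite num_lines_Posz // num_p. Qed.

Lemma expz_q : q.+1%:Z ^+ m = b.+1%:Z * q%:Z + 1.
Proof. by rewrite num_lines_Posz // num_q. Qed.

Definition polyE :=
  (expz_p, expz_q, num_p, num_q, PoszM, intS, polyCD, polyCN, polyCM, polyC1, polyC0,
   polyC_Posz).

Definition bool_of_ord2 (i : 'I_2) : bool := val i == 1%N.

Lemma bool_of_ord2_bij : bijective bool_of_ord2.
Proof.
by exists (fun x : bool => if x then 1 else 0) => [[[|[]]]//= lt|[]//]; apply: val_inj.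
Qed.

(** This is the block split off when the lines of the first factor are lumped. Lumping those of the
    second leaves [f_mx], and each of [b] differences contributes a linear factor. *)
Lemma char_poly_f :
  fdet (fun k l : option 'I_b.+1 =>
     y *+ (k == l) + ((compat k l)%:R * (line_size q.+1 l)%:R * p%:R : R))
  = char_poly (f_mx p.+1 q.+1 m) * (y + p%:R * q%:R) ^+ b.
Proof.
(* The factor [unit] casts scalar entries as the blocks expected by [fdet_bordered]. *)
have bij1 : bijective (@fst (option 'I_b.+1) unit).
  by exists (fun k => (k, tt)) => [[k []]|k].
rewrite (fdet_bij _ bij1).
pose W (_ _ : unit) : R := y + p%:R.
pose U (_ _ : unit) : R := p%:R * q%:R.
pose V (_ _ : unit) : R := p%:R.
pose X (_ _ : unit) : R := y + p%:R * q%:R.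
pose Y (_ _ : unit) : R := 0.
rewrite (eq_fdet (G := fun u v : option 'I_b.+1 * unit =>
          match u.1, v.1 with
          | None, None => W u.2 v.2
          | None, Some _ => U u.2 v.2
          | Some _, None => V u.2 v.2
          | Some i, Some j => X u.2 v.2 *+ (i == j) + Y u.2 v.2
          end)); last first.
  by move=> [[i|] []] [[j|] []]; rewrite compatE /= /W /U /V /X /Y /=; ring.
rewrite fdet_bordered fdet_unit; congr (_ * _).
have bij2 : bijective (fun i : 'I_2 => (bool_of_ord2 i, tt)).
  apply: (bij_comp (f := fun x : bool => (x, tt)) _ bool_of_ord2_bij).
  by exists fst => [//|[x []]].
apply: fdet_char_poly bij2 _ => i j; rewrite !mxE /bool_of_ord2 /=.
case: i => [[|[|//]]] ilt; case: j => [[|[|//]]] jlt;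
  rewrite /= !polyE /W /U /V /X /Y /y; ring.
Qed.

(** This is the block split off when the lines of the second factor are lumped after those of the
    first. *)
Lemma char_poly_g :
  fdet (fun u v : bool => match u, v with
     | false, false => y + q%:R
     | false, true => (p%:R * q%:R : R) *+ a.+1
     | true, false => q%:R
     | true, true => y + p%:R * q%:R
     end)
  = char_poly (g_mx p.+1 n q.+1).
Proof.
(* [g_mx] lists the lines before the identity, hence the negation. *)
apply: fdet_char_poly (bij_comp (f := negb) (inv_bij negbK) bool_of_ord2_bij) _.
move=> i j; rewrite !mxE /bool_of_ord2 /=.
case: i => [[|[|//]]] ilt; case: j => [[|[|//]]] jlt;
  rewrite /= !polyE /y; ring.
Qed.

(* [T1D] orders the four classes as 1, (a,1), (a,b), (1,b); the first boolean
   is about [b], the second about [a]. *)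
Definition pair_of_ord4 (i : 'I_4) : bool * bool :=
  nth (false, false) [:: (false, false); (false, true); (true, true); (true, false)] i.

Lemma pair_of_ord4_bij : bijective pair_of_ord4.
Proof.
apply: inj_card_bij; last by rewrite card_ord card_prod card_bool.
by move=> [[|[|[|[]]]]//= ?] [[|[|[|[]]]]//= ?] // _; apply: val_inj.
Qed.

(** [fdet_bordered] is applied twice, to the lines of the first factor and then to those of the
    second. The four remaining classes record which components are trivial. *)
Lemma fdet_line_quotient :
  fdet (fun c d : option 'I_a.+1 * option 'I_b.+1 =>
     y *+ (c == d) - (2 - (compat c.1 d.1 && compat c.2 d.2)%:R : R)
                     *+ (line_size p.+1 d.1 * line_size q.+1 d.2))
  = char_poly (T1D p.+1 n q.+1 m) * char_poly (g_mx p.+1 n q.+1) ^+ b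
    * (char_poly (f_mx p.+1 q.+1 m) * (y + p%:R * q%:R) ^+ b) ^+ a.
Proof.
pose s (l : option 'I_b.+1) : R := (line_size q.+1 l)%:R.
pose k (c d : option 'I_b.+1) : R := (compat c d)%:R.
pose W (c d : option 'I_b.+1) : R := y *+ (c == d) - (2 - k c d) * s d.
pose U (c d : option 'I_b.+1) : R := - ((2 - k c d) * s d * p%:R).
pose V (c d : option 'I_b.+1) : R := - ((2 - k c d) * s d).
pose X (c d : option 'I_b.+1) : R := y *+ (c == d) + k c d * s d * p%:R.
pose Y (c d : option 'I_b.+1) : R := - (2 * s d * p%:R).
rewrite (eq_fdet (G := fun u v : option 'I_a.+1 * option 'I_b.+1 =>
          match u.1, v.1 with
          | None, None => W u.2 v.2
          | None, Some _ => U u.2 v.2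
          | Some _, None => V u.2 v.2
          | Some i, Some j => X u.2 v.2 *+ (i == j) + Y u.2 v.2
          end)); last first.
  move=> [c c'] [d d']; rewrite -[X in _ - X]mulr_natr natrM xpair_eqE (compatE c) /=.
  rewrite /W /U /V /X /Y /k /s; case: c d => [i|] [j|] /=; try ring.
  by rewrite -[Some i == Some j]/(i == j); case: (i == j) => /=; ring.
rewrite fdet_bordered char_poly_f; congr (_ * _ ^+ a).
(* The coordinates are swapped so that the second factor becomes the block index. *)
rewrite (fdet_bij _ (h := fun x : option 'I_b.+1 * bool => (x.2, x.1))); last first.
  by exists (fun x => (x.2, x.1)) => [[]|[]].
pose W2 (u v : bool) : R := match u, v with
  | false, false => W None None | false, true => U None None *+ a.+1
  | true, false => V None None | true, true => X None None + Y None None *+ a.+1 end.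
(* Entries between the identity class and a line are the same for every line, so any line serves. *)
pose i0 : 'I_b.+1 := ord0.
pose U2 (u v : bool) : R := match u, v with
  | false, false => W None (Some i0) | false, true => U None (Some i0) *+ a.+1
  | true, false => V None (Some i0) | true, true => X None (Some i0) + Y None (Some i0) *+ a.+1 end.
pose V2 (u v : bool) : R := match u, v with
  | false, false => W (Some i0) None | false, true => U (Some i0) None *+ a.+1
  | true, false => V (Some i0) None | true, true => X (Some i0) None + Y (Some i0) None *+ a.+1 end.
pose X2 (u v : bool) : R := match u, v with
     | false, false => y + q%:R
     | false, true => (p%:R * q%:R : R) *+ a.+1
     | true, false => q%:R
     | true, true => y + p%:R * q%:R
     end.
pose Y2 (u v : bool) : R := match u, v with
  | false, false => - (2 * q%:R) | false, true => - (2 * q%:R * p%:R) *+ a.+1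
  | true, false => - (2 * q%:R) | true, true => - (2 * q%:R * p%:R) *+ a.+1 end.
rewrite (eq_fdet (G := fun u v : option 'I_b.+1 * bool =>
          match u.1, v.1 with
          | None, None => W2 u.2 v.2
          | None, Some _ => U2 u.2 v.2
          | Some _, None => V2 u.2 v.2
          | Some i, Some j => X2 u.2 v.2 *+ (i == j) + Y2 u.2 v.2
          end)); last first.
  move=> [[i|] []] [[j|] []]; rewrite /= /W /U /V /X /Y /k /s ?compatE //=; ring.
rewrite fdet_bordered -char_poly_g; congr (_ * _ ^+ b).
apply: fdet_char_poly pair_of_ord4_bij _ => i j; rewrite !mxE.
case: i => [[|[|[|[|//]]]]] ilt; case: j => [[|[|[|[|//]]]]] jlt;
  rewrite /= /W2 /U2 /V2 /X2 /Y2 /= /W /U /V /X /Y /k /s ?compatE /= !polyE /y; ring.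
Qed.

End Quotient.

(** Positivity allows the line counts to be written as successors; the upper bound makes the
    exponent of ['X + 1] a genuine difference. *)
Lemma num_lines_lt (p n : nat) : prime p -> (0 < n)%N ->
  (0 < num_lines p n < p ^ n)%N.
Proof.
move=> p_pr n_gt0; have pn := num_linesM n p_pr; have p1 := prime_gt1 p_pr.
have pn1 : (1 < p ^ n)%N by rewrite -(exp1n n) ltn_exp2r.
by apply/andP; split; nia.
Qed.

Theorem theorem4p19 (p q n m : nat) (gT : finGroupType) (A B : {group gT})
    (p_prime : prime p) (q_prime : prime q) (p_neq_q : p <> q)
    (n_gt0 : (0 < n)%N) (m_gt0 : (0 < m)%N)
    (abelA : (p.-abelem A)%g) (cardA : #|A| = (p ^ n)%N)
    (abelB : (q.-abelem B)%g) (cardB : #|B| = (q ^ m)%N)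
    (defG : (A \x B)%g = [set: gT]) :
  let alpha := num_lines p n in
  let beta := num_lines q m in
  char_poly (dist_mx (@enhanced_power_graph gT)) =
    char_poly (T1D p n q m)
    * ('X + 1) ^+ (p ^ n * q ^ m - (alpha + 1) * (beta + 1))
    * ('X + ((p%:Z - 1) * (q%:Z - 1) + 1)%:P) ^+ ((alpha - 1) * (beta - 1))
    * char_poly (f_mx p q m) ^+ (alpha - 1)
    * char_poly (g_mx p n q) ^+ (beta - 1).
Proof.
case: p p_prime p_neq_q abelA cardA => [//|p'] p_pr pq abelA' cardA'.
case: q q_prime pq abelB cardB => [//|q'] q_pr pq abelB' cardB'.
move=> alpha beta; rewrite /alpha /beta {alpha beta}.
have [hA [hA1 hAA hAf]] := line_index p_pr abelA' cardA'.
have [hB [hB1 hBB hBf]] := line_index q_pr abelB' cardB'.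
have /andP[a_gt0 a_lt] := num_lines_lt p_pr n_gt0.
have /andP[b_gt0 b_lt] := num_lines_lt q_pr m_gt0.
move: a_lt b_lt; case Ea: (num_lines p'.+1 n) a_gt0 hA hA1 hAA hAf => [//|a] _ hA hA1 hAA hAf.
case Eb: (num_lines q'.+1 m) b_gt0 hB hB1 hBB hBf => [//|b] _ hB hB1 hBB hBf a_lt b_lt.
have [_ defAB _ tiAB] := dprodP defG.
have Adiv g : divgr A B g \in A by rewrite mem_divgr // defAB inE.
have Brem g : remgr A B g \in B by rewrite mem_remgr // defAB inE.
pose cls g := (hA (divgr A B g), hB (remgr A B g)).
have cocE u v : cocyclic u v
    = compat (cls u).1 (cls v).1 && compat (cls u).2 (cls v).2.
  rewrite [u in LHS](divgr_eq A B) [v in LHS](divgr_eq A B).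
  rewrite (cocyclic_mul p_pr q_pr pq abelA' abelB' defG) //.
  rewrite (abelem_cocyclic abelA') // (abelem_cocyclic abelB') //.
  by rewrite /compat /= !hA1 // !hB1 // hAA // hBB.
have fibre (d : option 'I_a.+1 * option 'I_b.+1) :
    #|[pred g | cls g == d]| = (line_size p'.+1 d.1 * line_size q'.+1 d.2)%N.
  rewrite -hAf -hBf -(card_dprod_fibre defG); last 2 first.
  - by apply/subsetP=> x; rewrite inE => /andP[].
  - by apply/subsetP=> x; rewrite inE => /andP[].
  apply: eq_card => g; rewrite !inE Adiv Brem /= /cls.
  by case: d => d1 d2; rewrite xpair_eqE.
have cardT : #|gT| = (p'.+1 ^ n * q'.+1 ^ m)%N.
  by rewrite -cardsT -(dprod_card defG) cardA' cardB'.
pose k (c d : option 'I_a.+1 * option 'I_b.+1) : {poly int} :=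
  2 - (compat c.1 d.1 && compat c.2 d.2)%:R.
(* Since [D = 2J - I - M], the matrix [x - D] is [(x + 1) I - (2J - M)], and [2J - M] factors
   through [cls]. *)
have -> : char_poly (dist_mx (@enhanced_power_graph gT))
    = fdet (fun u v => ('X + 1 : {poly int}) *+ (u == v) - k (cls u) (cls v)).
  congr (\det _); apply/matrixP=> i j; rewrite !mxE polyC_Posz /k -cocE.
  have := gdist_enhanced_power_graph (enum_val i) (enum_val j).
  move/(congr1 (fun x : nat => x%:R : {poly int})); rewrite !natrD => <-.
  by rewrite (inj_eq enum_val_inj); ring.
have y_neq0 : ('X + 1 : {poly int}) != 0 by rewrite monic_neq0 // monicXaddC.
(* [fdet_fibres] needs an extra power of ['X + 1], one factor per class; it can be cancelled over an
   integral domain. *)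
apply: (mulIf (expf_neq0 #|{: option 'I_a.+1 * option 'I_b.+1}| y_neq0)).
rewrite fdet_fibres.
rewrite (eq_fdet (G := fun c d => ('X + 1) *+ (c == d)
    - k c d *+ (line_size p'.+1 d.1 * line_size q'.+1 d.2))); last first.
  by move=> c d; rewrite fibre.
rewrite (fdet_line_quotient p_pr q_pr Ea Eb).
have -> : ((p'.+1%:Z - 1) * (q'.+1%:Z - 1) + 1)%:P = 1 + p'%:R * q'%:R :> {poly int}.
  by rewrite !intS !(polyCD, polyCM, polyCN, polyC1, polyC_Posz); ring.
rewrite card_prod !card_option !card_ord cardT !addn1 !subn1 /=.
(* There are [a.+2 * b.+2] classes, at most the order of the group, so the power of ['X + 1] splits
   off the cancelling factor. *)
rewrite -[in LHS](subnK (leq_mul a_lt b_lt)) exprD exprMn -exprM [(b * a)%N]mulnC addrA.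
by ring.
Qed.
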